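(* Let $w=\psi(v)$ be a characteristic Sturmian word, with $v\in\{a,b\}^\omega$ containing both letters infinitely often. Then $D\psi(v)=\psi({}_+v)$.
   Context: Palindromization map on finite words: $\psi(\varepsilon)=\varepsilon$, $\psi(uz)=(\psi(u)z)^{(+)}$ ($z$ a letter, $t^{(+)}$ the shortest palindrome with prefix $t$); each $\psi(u)$ is a prefix of $\psi(uz)$, and for an infinite word $v$, $\psi(v)=\lim_n\psi(v_{[n]})$ where $v_{[n]}$ is the length-$n$ prefix. $\psi(v)$ is a characteristic Sturmian word when both letters occur infinitely often in $v$. Write such $v$ as $x_0^{\alpha_0}x_1^{\alpha_1}\cdots$ ($\alpha_i\ge1$, $x_{i+1}\ne x_i$); the index of $s=\psi(v)$ is $k=\alpha_0$. Let $\mu_k:a\mapsto a^kba,\ b\mapsto a^kb$ and $\hat\mu_k:a\mapsto b^ka,\ b\mapsto b^kab$. Then $s$ factors uniquely over $\{a^kb,a^kba\}$ if $s$ begins with $a$, resp. over $\{b^ka,b^kab\}$ if it begins with $b$, and the derivative is $Ds=\mu_k^{-1}(s)$, resp. $Ds=\hat\mu_k^{-1}(s)$ (the unique infinite word mapped to $s$). For such $v=x_0^{\alpha_0}\bar x_0\xi$ (with $\bar x_0$ the other letter), ${}_+v=\xi$, i.e. the longest suffix of $v$ immediately preceded by the letter different from the first letter of $v$. *)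

(* Defs.v *)
From mathcomp Require Import all_boot.
From mathcomp Require Import boolp classical_sets.

Set Implicit Arguments.
Unset Strict Implicit.
Unset Printing Implicit Defensive.

Local Open Scope classical_set_scope.

(* The binary alphabet {a, b} is bool, so that the letter other than x is ~~ x.
   Objects described as "the" word with some property are obtained with xget,
   which returns its first argument when no such word exists. *)
Notation letter := bool.
Definition la : letter := false.
Definition lb : letter := true.

Definition word := seq letter.
Definition infword := nat -> letter.
Definition inf_la : infword := fun=> la.

Definition palindrome (p : word) : bool := rev p == p.

Definition shortest_palindrome (t p : word) : Prop :=
  [/\ palindrome p, prefix t p &
      forall q : word, palindrome q -> prefix t q -> size p <= size q].

Definition palclos (t : word) : word :=
  xget [::] [set p : word | shortest_palindrome t p].

Definition psi (u : word) : word :=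
  foldl (fun p z => palclos (rcons p z)) [::] u.

Definition word_cvg (f : nat -> word) (w : infword) : Prop :=
  forall m, exists N, forall n, N <= n -> prefix (mkseq w m) (f n).

Definition word_lim (f : nat -> word) : infword :=
  xget inf_la [set w : infword | word_cvg f w].

Definition psi_inf (v : infword) : infword :=
  word_lim (fun n => psi (mkseq v n)).

Definition both_infinitely_often (v : infword) : Prop :=
  forall (x : letter) (n : nat), exists2 m, n <= m & v m = x.

Definition cat_inf (u : word) (xi : infword) : infword :=
  fun n => if n < size u then nth la u n else xi (n - size u).

(* v = x^k (~~ x) xi with x the first letter of v and k >= 1. *)
Definition first_block (v : infword) (k : nat) (xi : infword) : Prop :=
  0 < k /\ v = cat_inf (rcons (nseq k (v 0)) (~~ v 0)) xi.

Definition left_plus (v : infword) : infword :=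
  xget inf_la [set xi : infword | exists k, first_block v k xi].

(* The directive word v is determined by s, hence so is k. *)
Definition sturmian_index (s : infword) (k : nat) : Prop :=
  exists v xi, [/\ both_infinitely_often v, s = psi_inf v & first_block v k xi].

Definition mu (k : nat) (x : letter) : word :=
  if x == la then nseq k la ++ [:: lb; la] else nseq k la ++ [:: lb].

Definition mu_hat (k : nat) (x : letter) : word :=
  if x == la then nseq k lb ++ [:: la] else nseq k lb ++ [:: la; lb].

Definition morph_inf (f : letter -> word) (t : infword) : infword :=
  word_lim (fun n => flatten (map f (mkseq t n))).

Definition derivative (s : infword) : infword :=
  xget inf_la [set t : infword | exists2 k, sturmian_index s k &
    unique (fun t' : infword =>
              morph_inf (if s 0 == la then mu k else mu_hat k) t' = s) t].

Lemma palclosP (t : word) : shortest_palindrome t (palclos t).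
Proof.
apply: (@xgetPex _ [::] [set p : word | shortest_palindrome t p]).
pose Q n := `[< exists p : word, [/\ palindrome p, prefix t p & size p = n] >].
have exQ : exists n, Q n.
  exists (size (t ++ rev t)); apply/asboolP; exists (t ++ rev t).
  by rewrite prefix_prefix /palindrome rev_cat revK eqxx.
case: (ex_minnP exQ) => n /asboolP[p [pp tp sp]] minn.
by exists p; split=> // q pq tq; rewrite sp; apply/minn/asboolP; exists q.
Qed.

Lemma shortest_palindrome_uniq (t p : word) :
  shortest_palindrome t p -> p = palclos t.
Proof.
have [pq tq mq] := palclosP t; move: (palclos t) pq tq mq => q pq tq mq.
move=> [pp tp mp].
have spq : size p = size q.
  by apply/eqP; rewrite eqn_leq mp // mq.
have sp : size p <= size t + size t.
  rewrite -{2}(size_rev t) -size_cat; apply: mp; last exact: prefix_prefix.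
  by rewrite /palindrome rev_cat revK.
apply: (@eq_from_nth _ la) => // i ip.
have E r j : prefix t r -> j < size t -> nth la r j = nth la t j.
  by move=> /prefixP[r' ->] jt; rewrite nth_cat jt.
have [it|ti] := ltnP i (size t); first by rewrite (E p) // (E q).
rewrite -(eqP pp) -(eqP pq) !nth_rev -?spq //.
have jt : size p - i.+1 < size t.
  by rewrite ltn_subLR // addSn ltnS (leq_trans sp) // leq_add2r.
by rewrite (E p) // (E q).
Qed.

Lemma psi_rcons (u : word) (z : letter) :
  psi (rcons u z) = palclos (rcons (psi u) z).
Proof. by rewrite /psi foldl_rcons. Qed.

Lemma word_limE (f : nat -> word) (w : infword) :
  word_cvg f w -> word_lim f = w.
Proof.
move=> fw; have : word_cvg f (word_lim f).
  by apply: (@xgetPex _ inf_la [set w : infword | word_cvg f w]); exists w.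
move: (word_lim f) => w' fw'; apply/funext => i.
have [N HN] := fw i.+1; have [N' HN'] := fw' i.+1.
have /prefixP[s e] := HN _ (leq_maxl N N').
have /prefixP[s' e'] := HN' _ (leq_maxr N N').
have := congr1 (fun r => nth la (r : word) i) (etrans (esym e') e).
rewrite (nth_cat la (mkseq w' _)) (nth_cat la (mkseq w _)) !size_mkseq ltnSn.
by rewrite !nth_mkseq.
Qed.

Lemma word_lim_cvg (f : nat -> word) :
    (forall n, prefix (f n) (f n.+1)) -> (forall n, n <= size (f n)) ->
  word_cvg f (word_lim f).
Proof.
move=> fS fsz.
have fP m n : m <= n -> prefix (f m) (f n).
  move=> /subnK <-; elim: (n - m) => [|d IH]; first exact: prefix_refl.
  exact: prefix_trans IH (fS _).
suff cf : word_cvg f (fun i => nth la (f i.+1) i) by rewrite (word_limE cf).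
move=> m; exists m => n mn; apply: prefix_trans (fP _ _ mn).
rewrite prefixE size_mkseq; apply/eqP/(@eq_from_nth _ la).
  by rewrite size_take_min size_mkseq; apply/minn_idPl/fsz.
move=> i; rewrite size_take_min (minn_idPl (fsz m)) => im.
rewrite nth_take // nth_mkseq //.
have /prefixP[r er] := fP _ _ im.
by rewrite er nth_cat (fsz i.+1).
Qed.

Lemma psi_inf_cvg (v : infword) :
  word_cvg (fun n => psi (mkseq v n)) (psi_inf v).
Proof.
have S n : prefix (rcons (psi (mkseq v n)) (v n)) (psi (mkseq v n.+1)).
  rewrite [mkseq v n.+1](_ : _ = rcons (mkseq v n) (v n)).
    by rewrite psi_rcons; case: (palclosP (rcons (psi (mkseq v n)) (v n))).
  by rewrite /mkseq -addn1 iotaD map_cat cats1.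
apply: word_lim_cvg => n; first exact: prefix_trans (prefix_rcons _ _) (S n).
elim: n => // n IH.
by apply: leq_trans (size_prefix (S n)); rewrite size_rcons ltnS.
Qed.

Lemma morph_inf_cvg (f : letter -> word) (t : infword) :
    (forall x, 0 < size (f x)) ->
  word_cvg (fun n => flatten (map f (mkseq t n))) (morph_inf f t).
Proof.
move=> f0.
have S n : flatten (map f (mkseq t n.+1)) =
           flatten (map f (mkseq t n)) ++ f (t n).
  by rewrite /mkseq -addn1 iotaD !map_cat flatten_cat /= cats0.
apply: word_lim_cvg => n; first by rewrite S prefix_prefix.
elim: n => // n IH.
by rewrite S size_cat -addn1 leq_add.
Qed.

(* Main.v *)
From mathcomp Require Import all_boot.
From mathcomp Require Import boolp classical_sets.
Require Import Defs.

Set Implicit Arguments.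
Unset Strict Implicit.
Unset Printing Implicit Defensive.

(** For a letter [x] let [elem x] be the morphism fixing [x] and sending the
    other letter [y] to [xy].  Justin's formula
    [psi (x u) = elem x (psi u) x] passes to the limit as
    [psi (x v) = elem x (psi v)], and [mu_k], [hat mu_k] are the compositions
    [elem x ^ k \o elem y], so that [psi v] is the image of [psi (+v)] under the
    morphism defining the derivative.  Each [elem x] is injective on infinite
    words, since the second letter of the image reveals the first letter of the
    argument; hence so are [mu_k], [hat mu_k] and [psi] itself, which makes the
    index and the derivative unambiguous. *)

(** * Morphisms on finite words and a length bound for closures *)

Definition elem (x c : letter) : word := if c == x then [:: x] else [:: x; c].

Definition extend (f : letter -> word) (w : word) : word := flatten (map f w).

Lemma extend_cat f u w : extend f (u ++ w) = extend f u ++ extend f w.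
Proof. by rewrite /extend map_cat flatten_cat. Qed.

Lemma extend_cons f c w : extend f (c :: w) = f c ++ extend f w.
Proof. by []. Qed.

Lemma extend_seq1 f c : extend f [:: c] = f c.
Proof. by rewrite /extend /= cats0. Qed.

Lemma extend_comp f g w : extend f (extend g w) = extend (extend f \o g) w.
Proof. by elim: w => // c w IH; rewrite !extend_cons extend_cat IH. Qed.

Lemma leq_size_extend f w : (forall c, 0 < size (f c)) -> size w <= size (extend f w).
Proof.
move=> f0; elim: w => // c w IH.
by rewrite extend_cons size_cat /= -add1n leq_add.
Qed.

Lemma palindrome_of_rcons_rev (s : word) z : palindrome (rcons s z ++ rev s).
Proof. by rewrite /palindrome rev_cat rev_rcons revK cat_rcons. Qed.

Lemma size_palclos_rcons (s : word) z : size (palclos (rcons s z)) <= (size s).*2.+1.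
Proof.
have [_ _ /(_ _ (palindrome_of_rcons_rev s z) (prefix_prefix _ _))] :=
  palclosP (rcons s z).
by rewrite size_cat size_rcons size_rev addSn addnn.
Qed.

(** * Justin's formula on finite words *)

Section ElementaryMorphism.

Variable x : letter.
Implicit Types (c z : letter) (p q t u w y : word).

(* The conjugate of [elem x], for which [elem x w x = x (elem' x w)] and the
   image of a letter starts with this letter. *)
Definition elem' c : word := c :: (if c == x then [::] else [:: x]).

Local Notation E := (extend (elem x)).
Local Notation E' := (extend elem').

Lemma elem_gt0 c : 0 < size (elem x c).
Proof. by rewrite /elem; case: ifP. Qed.

Lemma elem_rconsE w : rcons (E w) x = x :: E' w.
Proof.
elim: w => // c w IH; rewrite !extend_cons rcons_cat IH /elem /elem'.
by case: eqP => [->|].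
Qed.

Lemma rev_elem' w : rev (E' w) = E (rev w).
Proof.
elim: w => // c w IH.
rewrite extend_cons rev_cat IH rev_cons -cats1 extend_cat extend_seq1.
by congr (_ ++ _); rewrite /elem /elem'; case: eqP => [->|].
Qed.

(** The images of letters form a prefix code and each starts with its own letter, so the lone letter
    [z] after [E' p] already names the next letter of [y]. *)
Lemma prefix_elem' p z y : prefix (rcons (E' p) z) (E' y) = prefix (rcons p z) y.
Proof.
elim: p y => [|d p IH] [|c y] //=; rewrite ?extend_cons /elem' /=.
  by rewrite !prefix0s.
have [->|] := eqVneq d c; last by [].
  by case: (c == x); rewrite /= ?eqxx IH.
Qed.

Lemma elem'_inj : injective E'.
Proof.
suff H w y : E' w = E' y -> prefix w y.
  move=> w y e; have /prefixP[r er] := H _ _ e.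
  have := size_prefix (H _ _ (esym e)); rewrite er size_cat -{2}[size w]addn0.
  by rewrite leq_add2l leqn0 => /nilP ->; rewrite cats0.
elim/last_ind: w => [|w z _] e; first exact: prefix0s.
by rewrite -prefix_elem' -e prefix_elem' prefix_refl.
Qed.

(** The default [x] makes the condition vacuous at and beyond the last letter, so a final letter
    other than [x] is allowed. *)
Definition isolated w := forall i, (nth x w i == x) || (nth x w i.+1 == x).

Lemma isolated_prefix t w : prefix t w -> isolated w -> isolated t.
Proof.
move=> /prefixP[r ->] H i; have := H i; rewrite !nth_cat.
have [_|/(nth_default x) ->] := ltnP i (size t); last by rewrite eqxx.
by have [//|/(nth_default x) ->] := ltnP i.+1 (size t); rewrite eqxx orbT.
Qed.

Lemma isolated_elem' w : isolated (E' w).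
Proof.
elim: w => [|c w IH] i; first by rewrite /= nth_nil eqxx.
rewrite extend_cons /elem'; case: (eqVneq c x) => [->|_] /=.
  by case: i => [|i] /=; rewrite ?eqxx.
by case: i => [|[|i]] /=; rewrite ?eqxx ?orbT.
Qed.

Lemma isolated_cons w : isolated w -> isolated (x :: w).
Proof. by move=> H [|i] /=; rewrite ?eqxx. Qed.

(** Such a word cuts into blocks [x] and [cx]; ending in [x] ensures that the last block is
    complete. The induction is on a length bound because a block may use two letters. *)
Lemma isolated_preimage w : isolated w -> last x w = x -> exists y, w = E' y.
Proof.
have [n] := ubnP (size w); elim: n w => // n IH [_ _ _|c w]; first by exists [::].
rewrite ltnS /= => sw iw.
have iw' : isolated w by move=> i; have := iw i.+1.
have [-> lw|cx] := eqVneq c x.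
  have [y ->] := IH w sw iw' lw.
  by exists (x :: y); rewrite extend_cons /elem' eqxx.
case: w sw iw iw' => [|d w] /= sw iw iw'; first by move=> /eqP; rewrite (negPf cx).
have /= := iw 0; rewrite (negPf cx) /= => /eqP dx lw; rewrite dx in lw *.
have [|y ->] := IH w (ltnW sw) _ lw; first by move=> i; have := iw' i.+1.
by exists (c :: y); rewrite extend_cons /elem' (negPf cx).
Qed.

(* This fails for arbitrary palindromes extending [rcons t z]; the closure is so
   short that any two adjacent letters occur, up to reversal, in [rcons t z]. *)
Lemma isolated_palclos t z : isolated (rcons t z) -> isolated (palclos (rcons t z)).
Proof.
have [/eqP pq /prefixP[r eq] _] := palclosP (rcons t z).
have := size_palclos_rcons t z.
move: (palclos _) pq eq => q pq eq sq it i.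
have H j : j < size t -> (nth x q j == x) || (nth x q j.+1 == x).
  move=> jt; have := it j.
  by rewrite eq !nth_cat size_rcons !ltnS jt (ltnW jt).
have [/H //|ti] := ltnP i (size t).
have [qi|iq] := leqP (size q) i.+1.
  by rewrite [nth x q i.+1]nth_default // eqxx orbT.
(* The reversal sends the pair at [i], [i.+1] to the pair starting at [size q - i.+2]; the bound on
   [size q] places that pair inside [rcons t z]. *)
have jt : size q - i.+2 < size t.
  by rewrite ltn_subLR // (leq_ltn_trans sq) // -addnn !addSn !ltnS leq_add2r.
rewrite -pq !nth_rev //; last exact: ltnW.
by rewrite -(subnSK iq) orbC H.
Qed.

(* Images of shorter words need not be shorter.  Here they are: in both
   palindromes the letters after [t] are the reversal of a prefix of [y], and
   the prefix is shorter for [palclos t]. *)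
Lemma size_elem'_palclos t y : palindrome y -> prefix t y ->
  size (E' (palclos t)) <= size (E' y).
Proof.
move=> /eqP py ty; have [/eqP pp tp mp] := palclosP t.
have spy := mp y (introT eqP py) ty.
have sp : size (palclos t) <= size t + size t.
  rewrite -{2}(size_rev t) -size_cat; apply: mp; last exact: prefix_prefix.
  by rewrite /palindrome rev_cat revK.
move: (palclos t) pp tp sp spy => p pp /prefixP[r ep] sp spy.
have [r' ey] := prefixP ty.
have srt : size r <= size t by move: sp; rewrite ep size_cat leq_add2l.
have {}pp : rev r = take (size r) y.
  have := congr1 (take (size r)) pp; rewrite {1}ep rev_cat take_size_cat ?size_rev //.
  by move=> ->; rewrite ep ey !takel_cat.
have rr' : size r <= size r' by move: spy; rewrite ep ey !size_cat leq_add2l.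
have {}py : rev r' = take (size r') y.
  by have := congr1 (take (size r')) py; rewrite {1}ey rev_cat take_size_cat ?size_rev.
have pr : prefix (rev r) (rev r').
  by rewrite pp py -(take_takel _ rr') prefix_take.
rewrite ep ey !extend_cat !size_cat leq_add2l.
rewrite -(size_rev (E' r)) -(size_rev (E' r')) !rev_elem'.
have /prefixP[r'' ->] := pr.
by rewrite extend_cat size_cat leq_addr.
Qed.

(** The map sending [w] to [x :: E' w] preserves palindromes. Minimality holds because the closure
    on the left is itself such an image, of a palindrome extending [rcons t z]. *)
Lemma palclos_elem t z :
  palclos (x :: rcons (E' t) z) = x :: E' (palclos (rcons t z)).
Proof.
have E'z : prefix (rcons (E' t) z) (E' (rcons t z)).
  by rewrite prefix_elem' prefix_refl.
have palE w : palindrome w -> palindrome (x :: E' w).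
  by move=> /eqP pw; rewrite /palindrome rev_cons rev_elem' pw elem_rconsE.
have [pp tp mp] := palclosP (rcons t z).
apply/esym/shortest_palindrome_uniq; split; first exact: palE.
  rewrite /= eqxx; apply: prefix_trans E'z _.
  by have /prefixP[r ->] := tp; rewrite extend_cat prefix_prefix.
move=> q0 pq0 tq0.
have [pq tq mq] := palclosP (x :: rcons (E' t) z).
(* The competitor [q0] need not be isolated, so it is replaced by the closure, which is. *)
apply: leq_trans (mq _ pq0 tq0).
have : isolated (palclos (x :: rcons (E' t) z)).
  apply: (@isolated_palclos (x :: E' t)); apply: isolated_cons.
  exact: isolated_prefix E'z (isolated_elem' _).
move: (palclos _) pq tq {mq} => [|c q] //= /eqP pq /andP[/eqP xc tq] iq.
subst c.
have lq : last x q = x.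
  by rewrite -[last x q]/(last x (x :: q)) -pq rev_cons last_rcons.
have [|y ey] := isolated_preimage _ lq; first by move=> i; have := iq i.+1.
subst q; rewrite ltnS; apply: size_elem'_palclos; last by rewrite -prefix_elem'.
(* Reversing [x :: E' y] gives [x :: E' (rev y)], so injectivity makes [y] a palindrome. *)
apply/eqP/elem'_inj; move: pq.
by rewrite rev_cons rev_elem' elem_rconsE => -[].
Qed.

(** By induction on the last letter of [u]: [elem_rconsE] moves the final [x] to the front, which is
    the form that [palclos_elem] handles. *)
Lemma psi_cons u : psi (x :: u) = rcons (E (psi u)) x.
Proof.
elim/last_ind: u => [|u z IH]; last first.
  by rewrite -rcons_cons !psi_rcons IH elem_rconsE rcons_cons palclos_elem elem_rconsE.
by apply/esym/shortest_palindrome_uniq; split; rewrite /palindrome /= ?eqxx // => q _ /size_prefix.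
Qed.

End ElementaryMorphism.

(** * Infinite words through their finite prefixes *)

Implicit Types (f g : infword) (w : word).

Definition prefix_inf w f := forall i, i < size w -> nth la w i = f i.

Lemma prefix_infE w f : prefix_inf w f -> w = mkseq f (size w).
Proof.
move=> wf; apply: (@eq_from_nth _ la); rewrite ?size_mkseq // => i iw.
by rewrite wf // nth_mkseq.
Qed.

Lemma prefix_inf_eq f g :
  (forall n, exists w, [/\ n <= size w, prefix_inf w f & prefix_inf w g]) -> f = g.
Proof.
move=> H; apply/funext => i; have [w [iw wf wg]] := H i.+1.
by rewrite -wf // wg.
Qed.

(** Convergence only controls late terms; monotonicity makes [F n] a prefix of one of them. *)
Lemma word_cvg_prefix_inf (F : nat -> word) f n :
  (forall m, prefix (F m) (F m.+1)) -> word_cvg F f -> prefix_inf (F n) f.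
Proof.
move=> FS Ff i iF; have [N HN] := Ff i.+1.
have /prefixP[r er] := HN _ (leq_maxl N n).
have : prefix (F n) (F (maxn N n)).
  rewrite -(subnK (leq_maxr N n)).
  by elim: (_ - _) => [|d IH]; rewrite ?prefix_refl // (prefix_trans IH).
move=> /prefixP[r' er']; have := congr1 (nth la ^~ i) (etrans (esym er') er).
by rewrite !nth_cat iF size_mkseq ltnSn nth_mkseq.
Qed.

Lemma mkseqS f n : mkseq f n.+1 = rcons (mkseq f n) (f n).
Proof. by rewrite /mkseq -addn1 iotaD map_cat cats1. Qed.

Lemma prefix_psi_rcons u z : prefix (rcons (psi u) z) (psi (rcons u z)).
Proof. by rewrite psi_rcons; case: (palclosP (rcons (psi u) z)). Qed.

Lemma leq_size_psi u : size u <= size (psi u).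
Proof.
elim/last_ind: u => // u z IH; apply: leq_trans (size_prefix (prefix_psi_rcons u z)).
by rewrite !size_rcons.
Qed.

Lemma psi_prefix_inf f n : prefix_inf (psi (mkseq f n)) (psi_inf f).
Proof.
apply: (word_cvg_prefix_inf (F := fun n => psi (mkseq f n))) (psi_inf_cvg f) => m.
by rewrite mkseqS; apply: prefix_trans (prefix_rcons _ _) (prefix_psi_rcons _ _).
Qed.

Section InfiniteMorphism.

Variable h : letter -> word.
Hypothesis h0 : forall c, 0 < size (h c).

Lemma morph_prefix_inf w f : prefix_inf w f -> prefix_inf (extend h w) (morph_inf h f).
Proof.
move=> /prefix_infE ->.
apply: (word_cvg_prefix_inf (F := fun n => extend h (mkseq f n))) (morph_inf_cvg f h0).
by move=> m; rewrite mkseqS -cats1 extend_cat prefix_prefix.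
Qed.

(** Transfers identities from finite to infinite words: composition, first-letter splitting and
    Justin's formula all pass to the limit through it. *)
Lemma morph_inf_eq f g :
  (forall n, exists w, [/\ n <= size w, prefix_inf w f & prefix_inf (extend h w) g]) ->
  morph_inf h f = g.
Proof.
move=> H; apply: prefix_inf_eq => n; have [w [nw wf wg]] := H n.
exists (extend h w); split=> //; last exact: morph_prefix_inf.
exact: leq_trans nw (leq_size_extend w h0).
Qed.

End InfiniteMorphism.

Lemma mkseq_prefix_inf f n : prefix_inf (mkseq f n) f.
Proof. by move=> i; rewrite size_mkseq => ni; rewrite nth_mkseq. Qed.

Lemma morph_inf_comp h h' f :
    (forall c, 0 < size (h c)) -> (forall c, 0 < size (h' c)) ->
  morph_inf h (morph_inf h' f) = morph_inf (extend h \o h') f.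
Proof.
move=> h0 h'0; apply/esym/morph_inf_eq => [c|n].
  exact: leq_trans (h'0 c) (leq_size_extend _ h0).
exists (mkseq f n); split; first by rewrite size_mkseq.
  exact: mkseq_prefix_inf.
rewrite -extend_comp; do 2 apply: morph_prefix_inf => //.
exact: mkseq_prefix_inf.
Qed.

Lemma cat_inf_cons c w f : cat_inf (c :: w) f = cat_inf [:: c] (cat_inf w f).
Proof. by apply/funext => -[|n] //; rewrite /cat_inf /= ltnS !subSS subn0. Qed.

Lemma cat_inf_prefix_inf u w f : prefix_inf w f -> prefix_inf (u ++ w) (cat_inf u f).
Proof.
move=> wf i; rewrite size_cat nth_cat /cat_inf => iuw.
by case: (ltnP i (size u)) => // ui; rewrite wf // ltn_subLR.
Qed.

Lemma mkseq_cat_inf1 c f n : mkseq (cat_inf [:: c] f) n.+1 = c :: mkseq f n.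
Proof.
apply/esym; rewrite [LHS](@prefix_infE _ (cat_inf [:: c] f)) /= ?size_mkseq //.
exact/(cat_inf_prefix_inf (u := [:: c]))/mkseq_prefix_inf.
Qed.

Lemma morph_inf_cons h c f : (forall c, 0 < size (h c)) ->
  morph_inf h (cat_inf [:: c] f) = cat_inf (h c) (morph_inf h f).
Proof.
move=> h0; apply: morph_inf_eq => // n.
exists (c :: mkseq f n); split; first by rewrite /= size_mkseq.
  exact/(cat_inf_prefix_inf (u := [:: c]))/mkseq_prefix_inf.
rewrite extend_cons; apply/cat_inf_prefix_inf/morph_prefix_inf => //.
exact: mkseq_prefix_inf.
Qed.

(** * Justin's formula and injectivity on infinite words *)

Lemma psi_inf_cons c f :
  psi_inf (cat_inf [:: c] f) = morph_inf (elem c) (psi_inf f).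
Proof.
apply/esym/morph_inf_eq => [|n]; first exact: elem_gt0.
exists (psi (mkseq f n)); split; last 1 first.
(* The final letter [c] in the finite formula lies beyond [iw], so it disappears in the limit. *)
- move=> i iw; rewrite -(psi_prefix_inf (n := n.+1)) mkseq_cat_inf1 psi_cons.
    by rewrite nth_rcons iw.
  by rewrite size_rcons ltnW.
- by apply: leq_trans (leq_size_psi _); rewrite size_mkseq.
- exact: psi_prefix_inf.
Qed.

Lemma inf_eta f : f = cat_inf [:: f 0] (fun n => f n.+1).
Proof. by apply/funext => -[|n] //; rewrite /cat_inf /= subn1. Qed.

Lemma morph_elem0 x f : morph_inf (elem x) f 0 = x.
Proof.
rewrite [f]inf_eta morph_inf_cons; last exact: elem_gt0.
by rewrite /cat_inf /elem; case: eqP.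
Qed.

(** If [f 0] is [x], its image is a single letter and the next image again starts with [x];
    otherwise [f 0] is the second letter of its own image. *)
Lemma morph_elem1 x f : morph_inf (elem x) f 1 = f 0.
Proof.
rewrite [f in LHS]inf_eta morph_inf_cons; last exact: elem_gt0.
by rewrite /cat_inf /elem; case: eqP => //= ->; rewrite morph_elem0.
Qed.

Lemma cat_inf_inj u : injective (cat_inf u).
Proof.
move=> f g fg; apply/funext => n; have := congr1 (@^~ (size u + n)) fg.
by rewrite /cat_inf ltnNge leq_addr /= addKn.
Qed.

Lemma morph_elem_inj x : injective (morph_inf (elem x)).
Proof.
move=> f g fg; apply/funext => n; elim: n f g fg => [|n IH] f g fg.
  by rewrite -(morph_elem1 x) fg morph_elem1.
have fg0 : f 0 = g 0 by rewrite -(morph_elem1 x) fg morph_elem1.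
apply: (IH (fun n => f n.+1) (fun n => g n.+1)); move: fg.
rewrite [f in LHS]inf_eta [g in RHS]inf_eta fg0.
by rewrite !morph_inf_cons; [exact: cat_inf_inj | exact: elem_gt0..].
Qed.

Lemma psi_inf0 f : psi_inf f 0 = f 0.
Proof. by rewrite {1}[f]inf_eta psi_inf_cons morph_elem0. Qed.

(** The first letter of [psi_inf f] is that of [f]; Justin's formula and injectivity of [elem] then
    strip it. *)
Lemma psi_inf_inj : injective psi_inf.
Proof.
move=> f g fg; apply/funext => n; elim: n f g fg => [|n IH] f g fg.
  by rewrite -psi_inf0 fg psi_inf0.
have fg0 : f 0 = g 0 by rewrite -psi_inf0 fg psi_inf0.
apply: (IH (fun n => f n.+1) (fun n => g n.+1)); move: fg.
by rewrite [f in LHS]inf_eta [g in RHS]inf_eta fg0 !psi_inf_cons => /morph_elem_inj.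
Qed.

(* The composition [elem x ^ k \o elem (~~ x)]; it is [mu k] for [x = a] and
   [mu_hat k] for [x = b]. *)
Definition block_morph x k c : word := nseq k x ++ elem (~~ x) c.

Lemma block_morph_gt0 x k c : 0 < size (block_morph x k c).
Proof. by rewrite size_cat addn_gt0 elem_gt0 orbT. Qed.

Lemma block_morphE x k :
  block_morph x k = (if x == la then mu k else mu_hat k).
Proof. by apply/funext => c; case: x; case: c. Qed.

(** The word [elem (~~ x) c] has a single [~~ x], at its start, so [elem x] only adds one [x] in
    front. *)
Lemma extend_elem_block x k : extend (elem x) \o block_morph x k = block_morph x k.+1.
Proof.
apply/funext => c; rewrite /block_morph /= extend_cat.
have -> : extend (elem x) (nseq k x) = nseq k x.
  by elim: k => //= k IH; rewrite extend_cons /elem eqxx IH.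
have -> : extend (elem x) (elem (~~ x) c) = x :: elem (~~ x) c.
  by case: x; case: c.
by elim: k => //= k ->.
Qed.

Lemma morph_block_succ x k f :
  morph_inf (elem x) (morph_inf (block_morph x k) f) =
  morph_inf (block_morph x k.+1) f.
Proof.
rewrite morph_inf_comp ?extend_elem_block //; first exact: elem_gt0.
exact: block_morph_gt0.
Qed.

Lemma morph_block_inj x k : injective (morph_inf (block_morph x k)).
Proof.
elim: k => [|k IH] f g; first exact: morph_elem_inj.
by rewrite -!morph_block_succ => /morph_elem_inj/IH.
Qed.

Lemma psi_inf_block x k f :
  psi_inf (cat_inf (rcons (nseq k x) (~~ x)) f) =
  morph_inf (block_morph x k) (psi_inf f).
Proof.
elim: k => [|k IH]; first exact: psi_inf_cons.
by rewrite cat_inf_cons psi_inf_cons IH morph_block_succ.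
Qed.

(** * The first block of the directive word, and the derivative *)

Lemma first_block_exists v : both_infinitely_often v ->
  exists k xi, first_block v k xi.
Proof.
move=> hv; have [m _ vm] := hv (~~ v 0) 0.
have exP : exists m, v m == ~~ v 0 by exists m; rewrite vm.
(* The exponent is the least position of a letter other than [v 0]. *)
case: (ex_minnP exP) => k /eqP vk mink; exists k, (fun n => v (k.+1 + n)); split.
  by case: k vk {mink} => //; case: (v 0).
apply/funext => i; rewrite /cat_inf size_rcons size_nseq nth_rcons size_nseq nth_nseq.
case: (ltngtP i k) => ik.
- rewrite ltnW ?ltnS //; apply/eqP; apply: contraTT ik => vi.
  by rewrite -leqNgt mink //; move: vi; case: (v i); case: (v 0).
- by rewrite ltnNge ik /= subnKC.
- by rewrite ik ltnSn vk.
Qed.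

Lemma first_blockE v k xi : first_block v k xi ->
  [/\ forall i, i < k -> v i = v 0, v k = ~~ v 0 & xi = fun n => v (k.+1 + n)].
Proof.
move=> [k0 ev]; have H i : v i = cat_inf (rcons (nseq k (v 0)) (~~ v 0)) xi i.
  by rewrite -ev.
have sz : size (rcons (nseq k (v 0)) (~~ v 0)) = k.+1 by rewrite size_rcons size_nseq.
split.
- by move=> i ik; rewrite H /cat_inf sz ltnW // nth_rcons size_nseq ik nth_nseq ik.
- by rewrite H /cat_inf sz ltnSn nth_rcons size_nseq ltnn eqxx.
- by apply/funext => n; rewrite H /cat_inf sz ltnNge leq_addr /= addKn.
Qed.

Lemma first_block_uniq v k xi k' xi' :
  first_block v k xi -> first_block v k' xi' -> k = k' /\ xi = xi'.
Proof.
move=> /first_blockE[vi vk ->] /first_blockE[vi' vk' ->].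
suff -> : k = k' by [].
case: (ltngtP k k') => // [/vi'|/vi]; rewrite ?vk ?vk'; by case: (v 0).
Qed.

Theorem mainTheorem18 (v : infword) (hv : both_infinitely_often v) :
  derivative (psi_inf v) = psi_inf (left_plus v).
Proof.
have [k [xi vxi]] := first_block_exists hv.
have ek : morph_inf (if psi_inf v 0 == la then mu k else mu_hat k) =
          morph_inf (block_morph (v 0) k) by rewrite psi_inf0 block_morphE.
have -> : left_plus v = xi.
  have [k' vxi'] : exists k', first_block v k' (left_plus v).
    apply: (@xgetPex _ inf_la [set xi : infword | exists k, first_block v k xi]).
    by exists xi, k.
  by have [] := first_block_uniq vxi' vxi.
have sol : morph_inf (block_morph (v 0) k) (psi_inf xi) = psi_inf v.
  by rewrite -psi_inf_block -vxi.2.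
rewrite /derivative; set S := (X in xget _ X).
have [|k' [v' [xi' [_ vv' vxi']]]] := @xgetPex _ inf_la S.
  exists (psi_inf xi), k; first by exists v, xi.
  by rewrite ek; split=> // t; rewrite -sol => /morph_block_inj.
(* The index chosen comes from some [v'] with the same image under [psi_inf]; injectivity identifies
   [v'] with [v], hence [k'] with [k]. *)
move: vxi'; rewrite -(psi_inf_inj vv') => vxi'.
have [<- _] := first_block_uniq vxi vxi'.
by rewrite ek => -[+ _]; rewrite -sol => /morph_block_inj.
Qed.
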